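(* For a positive integer $n$, let $\mathcal{A}_n^+\subseteq\mathfrak{S}_n$ be the set of even permutations and $\mathcal{A}_n^-$ the set of odd permutations. For $\pi=\pi_1\cdots\pi_n\in\mathfrak{S}_n$ let $\mathrm{exc}(\pi)=|\{i\in[n-1]:\pi_i>i\}|$, and let $\mathrm{AE}_n^{\pm}(t)=\sum_{\pi\in\mathcal{A}_n^{\pm}}t^{\mathrm{exc}(\pi)}$. Then, as formal power series, $$\frac{\mathrm{AE}_n^{\pm}(t)}{(1-t)^{n+1}}=\sum_{k\ge 0}\frac{(k+1)^n\pm(k+1)}{2}\,t^k,$$ with the same choice of sign on both sides. *)

(* Defs.v *)
From mathcomp Require Import all_boot all_order all_algebra all_fingroup.

Set Implicit Arguments.
Unset Strict Implicit.
Unset Printing Implicit Defensive.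

Import GRing.Theory.
Local Open Scope ring_scope.

(* A formal power series over a field is its coefficient sequence; equality of
   series is coefficientwise, i.e. =1. *)
Definition fps (F : fieldType) := nat -> F.

Section FPS.
Variable F : fieldType.
Implicit Types f g : fps F.

Definition fps_of_poly (p : {poly F}) : fps F := fun k => p`_k.

Definition fps_one : fps F := fun k => (k == 0%N)%:R.

Definition fps_mul f g : fps F := fun k => \sum_(i < k.+1) f i * g (k - i)%N.

(* The first m coefficients of the inverse series, from the recursion
   f_0 g_m = [m = 0] - \sum_(i < m) g_i f_(m - i). *)
Fixpoint fps_inv_seq f (m : nat) : seq F :=
  if m is m'.+1 then
    let s := fps_inv_seq f m' in
    rcons s (((m' == 0%N)%:R - \sum_(i < m') s`_i * f (m' - i)%N) / f 0%N)
  else [::].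

(* Meaningful when f 0 != 0; see fps_mulV. *)
Definition fps_inv f : fps F := fun k => (fps_inv_seq f k.+1)`_k.

Definition fps_div f g : fps F := fps_mul f (fps_inv g).

Lemma size_fps_inv_seq f m : size (fps_inv_seq f m) = m.
Proof. by elim: m => //= m IH; rewrite size_rcons IH. Qed.

Lemma nth_fps_inv_seq f m i : (i < m)%N -> (fps_inv_seq f m)`_i = fps_inv f i.
Proof.
elim: m => // m IH; rewrite ltnS leq_eqVlt => /orP[/eqP-> //|lt_im].
by rewrite /= nth_rcons size_fps_inv_seq lt_im IH.
Qed.

Lemma fps_invE f k :
  fps_inv f k = ((k == 0%N)%:R - \sum_(i < k) fps_inv f i * f (k - i)%N) / f 0%N.
Proof.
rewrite {1}/fps_inv /= nth_rcons size_fps_inv_seq ltnn eqxx.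
by congr ((_ - _) / _); apply: eq_bigr => i _; rewrite nth_fps_inv_seq.
Qed.

Lemma fps_mulV f : f 0%N != 0 -> fps_mul (fps_inv f) f =1 fps_one.
Proof.
move=> f0 k; rewrite /fps_mul big_ord_recr /= subnn [fps_inv f k]fps_invE.
by rewrite divfK // addrC subrK.
Qed.

End FPS.

Definition even_perms (n : nat) : {set 'S_n} := [set s : 'S_n | ~~ odd_perm s].
Definition odd_perms (n : nat) : {set 'S_n} := [set s : 'S_n | odd_perm s].

(* The index i : 'I_n stands for the position i + 1, so i.+1 < n says that
   this position lies in [n - 1]. *)
Definition exc (n : nat) (s : 'S_n) : nat :=
  #|[set i : 'I_n | (i.+1 < n)%N && (i < s i)%N]|.

Definition AE_plus (n : nat) : {poly rat} := \sum_(s in even_perms n) 'X^(exc s).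
Definition AE_minus (n : nat) : {poly rat} := \sum_(s in odd_perms n) 'X^(exc s).

(* Main.v *)
Require Import Defs.
From mathcomp Require Import all_boot all_order all_algebra all_fingroup.
From mathcomp Require Import ring.

(** For [e = 1, -1] let [P_n(t)] be the sum of [e^[pi odd] t^exc(pi)] over [S_n].
    Inserting a new largest letter [n] into the cycles of [pi] in [S_n], either
    as a fixed point or just after some [i], flips the parity in the second case
    only, and then creates an excedance unless [i] was one already.  Hence
    [P_(n+1) = (1 + e n t) P_n + e t (1 - t) P_n'].  For [e = -1] this gives
    [P_n = (1 - t)^(n-1)]; for [e = 1] the Euler operator [t d/dt], which
    preserves congruences modulo [t^N], gives
    [P_n / (1 - t)^(n+1) = sum_k (k+1)^n t^k].  Half the sum and half the
    difference of the two are the claimed identities. *)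

Import GRing.Theory.
Local Open Scope ring_scope.

(** * Division of power series through polynomial congruences *)

Section PowerSeries.
Variable F : fieldType.

Lemma poly_coef_trunc (h : nat -> F) (p : {poly F}) (N : nat) :
  (forall k, (k < N)%N -> p`_k = h k) ->
  exists r : {poly F}, p = \poly_(i < N) h i + r * 'X^N.
Proof.
move=> ph; exists (drop_poly N p); rewrite -{1}(poly_take_drop N p).
congr (_ + _); apply/polyP => i; rewrite coef_take_poly coef_poly.
by case: ltnP => // /ph.
Qed.

Lemma coef_modXn (p q r : {poly F}) (N k : nat) :
  p = q + r * 'X^N -> (k < N)%N -> p`_k = q`_k.
Proof. by move=> -> kN; rewrite coefD coefMXn kN addr0. Qed.

Lemma coef_mul_trunc (f g : fps F) (N k : nat) : (k < N)%N ->
  (\poly_(i < N) f i * \poly_(i < N) g i)`_k = fps_mul f g k.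
Proof.
move=> kN; rewrite coefM; apply: eq_bigr => i _; rewrite !coef_poly.
have iN : (i < N)%N by apply: leq_trans kN; apply: ltn_ord.
by rewrite iN (leq_ltn_trans (leq_subr _ _) kN).
Qed.

(** Reduces a quotient of series to congruences [p = q * h] modulo each ['X^N]: multiplying by the
    truncated inverse [V] of [q] recovers [h] below degree [N]. *)
Lemma fps_div_polyE (p q : {poly F}) (h : fps F) : q`_0 != 0 ->
    (forall N, exists r, p = q * \poly_(i < N) h i + r * 'X^N) ->
  fps_div (fps_of_poly p) (fps_of_poly q) =1 h.
Proof.
move=> q0 hp k; pose N := k.+1.
pose v := fps_inv (fps_of_poly q); pose V := \poly_(i < N) v i.
have [r1 p_eq] := hp N.
have [r2 pE] : exists r, p = \poly_(i < N) p`_i + r * 'X^N.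
  exact: poly_coef_trunc.
have [r3 qE] : exists r, q = \poly_(i < N) q`_i + r * 'X^N.
  exact: poly_coef_trunc.
have [r4 VqE] : exists r, V * \poly_(i < N) q`_i = 1 + r * 'X^N.
  have [i iN|r ->] := @poly_coef_trunc (fps_one F) (V * \poly_(i < N) q`_i) N.
    by rewrite coef_mul_trunc // fps_mulV.
  exists r; congr (_ + _); apply/polyP => i; rewrite coef_poly coef1 /fps_one.
  by case: i => [|i] //; case: (i.+1 < N)%N.
rewrite /fps_div -(@coef_mul_trunc _ _ N) // -/v -/V.
set H := \poly_(i < N) h i in p_eq.
set p' := \poly_(i < N) p`_i in pE; set q' := \poly_(i < N) q`_i in qE VqE.
rewrite -[\poly_(i < N) fps_of_poly p i]/p'.
transitivity H`_k; last by rewrite coef_poly ltnSn.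
(* The witness collects the errors left by [V * q' = 1], [q = q'] and [p' = q * H] modulo ['X^N]. *)
apply: (@coef_modXn _ _ (H * r4 + r3 * H * V + (r1 - r2) * V) N) => //.
have -> : p' = q * H + r1 * 'X^N - r2 * 'X^N by rewrite -p_eq {1}pE addrK.
rewrite {1}qE.
have -> : H + (H * r4 + r3 * H * V + (r1 - r2) * V) * 'X^N =
   H * (1 + r4 * 'X^N) + (r3 * H * V + (r1 - r2) * V) * 'X^N by ring.
by rewrite -VqE; ring.
Qed.

End PowerSeries.

(** * Excedances and parity under insertion of a largest letter *)

Section Excedances.

Lemma exc_sum (n : nat) (s : 'S_n) : exc s = (\sum_(i < n) (i < s i))%N.
Proof.
rewrite /exc -sum1_card (eq_bigl (fun i : 'I_n => i < s i)%N).
  by rewrite big_mkcond; apply: eq_bigr => i _; case: ifP.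
move=> i; rewrite inE; apply/andP/idP => [[]//|lt_i]; split=> //.
exact: leq_ltn_trans lt_i (ltn_ord _).
Qed.

(* [n] becomes a fixed point if [i = n], and otherwise sits between [i] and
   [s i] in the cycle of [i]. *)
Definition insert_max (n : nat) (x : 'S_n * 'I_n.+1) : 'S_n.+1 :=
  (tperm x.2 ord_max * lift_perm ord_max ord_max x.1)%g.

(** The index [i] is recovered as the preimage of [ord_max]; cancelling the transposition then gives
    [s]. The cardinalities agree since [(n+1)! = (n+1) n!]. *)
Lemma insert_max_bij (n : nat) : bijective (@insert_max n).
Proof.
apply: inj_card_bij; last first.
  by rewrite card_prod !card_Sn card_ord factS mulnC.
move=> [s i] [t j]; rewrite /insert_max /= => eq_st.
have eq_ij : i = j.
  have : (tperm j ord_max * lift_perm ord_max ord_max t)%g i = ord_max.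
    by rewrite -eq_st permM tpermL lift_perm_id.
  rewrite permM -[X in _ = X](lift_perm_id ord_max ord_max t).
  by move/perm_inj/(canRL (tpermK _ _)); rewrite tpermR.
move: eq_st; rewrite -eq_ij => /mulgI eq_st; congr (_, _).
apply/permP => k; apply: (@lift_inj _ ord_max).
by rewrite -!(lift_perm_lift ord_max) eq_st.
Qed.

Lemma exc_recr (n : nat) (s : 'S_n.+1) :
  exc s = (\sum_(j < n) (j < s (lift ord_max j)))%N.
Proof.
rewrite exc_sum big_ord_recr /= ltnNge -ltnS ltn_ord addn0.
apply: eq_bigr => j _; congr (nat_of_bool (_ < s _)%N); apply: val_inj.
by rewrite /= /bump leqNgt ltn_ord.
Qed.

Lemma exc_insert_fix (n : nat) (s : 'S_n) : exc (insert_max n (s, ord_max)) = exc s.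
Proof.
rewrite exc_recr exc_sum; apply: eq_bigr => j _.
by rewrite /insert_max tperm1 mul1g lift_perm_lift lift_max.
Qed.

(** Position [i] now maps to the maximum, so it is an excedance whatever it was before; the other
    old positions keep their values, and the last position never counts. *)
Lemma exc_insert_lift (n : nat) (s : 'S_n) (i : 'I_n) :
  exc (insert_max n (s, lift ord_max i)) = (exc s + ~~ (i < s i))%N.
Proof.
rewrite exc_recr exc_sum (bigD1 i) //= [in RHS](bigD1 i) //=.
rewrite permM tpermL lift_perm_id ltn_ord addnAC; congr addn.
  by case: ltnP.
apply: eq_bigr => j ji; rewrite permM tpermD ?lift_perm_lift ?lift_max //.
  by rewrite (inj_eq lift_inj) eq_sym.
exact: neq_lift.
Qed.

Lemma odd_insert_fix (n : nat) (s : 'S_n) :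
  odd_perm (insert_max n (s, ord_max)) = odd_perm s.
Proof. by rewrite /insert_max tperm1 mul1g odd_lift_perm addbb. Qed.

Lemma odd_insert_lift (n : nat) (s : 'S_n) (i : 'I_n) :
  odd_perm (insert_max n (s, lift ord_max i)) = ~~ odd_perm s.
Proof.
by rewrite /insert_max odd_permM odd_tperm odd_lift_perm addbb eq_sym neq_lift.
Qed.

End Excedances.

(** * Recursion and generating functions of the weighted sums *)

Section Eulerian.
Variable F : fieldType.
Implicit Type e : F.

Definition weighted_eulerian e (n : nat) : {poly F} :=
  \sum_(s : 'S_n) e ^+ odd_perm s *: 'X^(exc s).

Lemma XderivXn (k : nat) : 'X * ('X^k)^`() = k%:R * 'X^k :> {poly F}.
Proof.
rewrite derivXn; case: k => [|k]; first by rewrite mulr0n mulr0 mul0r.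
by rewrite /= -mulr_natl mulrCA -exprS.
Qed.

(** With [m = exc s], the sum is [m X^m + (n - m) X^(m+1)], and the factor [m] comes from applying
    [X d/dX] to [X^m]. *)
Lemma sum_Xn_nonexc (n : nat) (s : 'S_n) :
  \sum_(i < n) ('X^(exc s + ~~ (i < s i)%N) : {poly F}) =
  (n%:R * 'X) * 'X^(exc s) + 'X * (1 - 'X) * ('X^(exc s))^`().
Proof.
have exc_natr : (exc s)%:R = \sum_(i < n) (i < s i)%N%:R :> {poly F}.
  by rewrite exc_sum natr_sum.
have n_natr : n%:R = \sum_(i < n) 1 :> {poly F} by rewrite sumr_const card_ord.
rewrite -['X * _ * _]mulrA [X in _ + X]mulrCA XderivXn exc_natr n_natr.
rewrite !mulr_suml mulr_sumr -big_split /=.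
apply: eq_bigr => i _.
by case: (i < s i)%N; rewrite /= ?addn0 ?addn1 ?exprS; ring.
Qed.

Lemma weighted_eulerianS e (n : nat) : e ^+ 2 = 1 ->
  weighted_eulerian e n.+1 =
    (1 + e *: (n%:R * 'X)) * weighted_eulerian e n +
    e *: ('X * (1 - 'X) * (weighted_eulerian e n)^`()).
Proof.
move=> e2; rewrite /weighted_eulerian (reindex (@insert_max n)) /=; last first.
  exact/onW_bij/insert_max_bij.
rewrite -(pair_bigA _ (fun s i => e ^+ odd_perm (insert_max n (s, i)) *:
  'X^(exc (insert_max n (s, i))))) /=.
rewrite [_^`()]raddf_sum !mulr_sumr scaler_sumr -big_split /=.
apply: eq_bigr => s _; rewrite derivZ.
rewrite (bigD1_ord ord_max) //= odd_insert_fix exc_insert_fix.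
under eq_bigr => i _ do rewrite odd_insert_lift exc_insert_lift.
rewrite -scaler_sumr sum_Xn_nonexc.
have -> : e ^+ (~~ odd_perm s) = e ^+ odd_perm s * e.
  by case: (odd_perm s); rewrite ?mul1r // expr1 -expr2 e2.
move: (e ^+ odd_perm s) 'X^(exc s) => a p.
by rewrite -!mul_polyC polyCM; ring.
Qed.

Lemma weighted_eulerian0 e : weighted_eulerian e 0 = 1.
Proof.
rewrite /weighted_eulerian (big_pred1 1%g) => [|s].
  by rewrite odd_perm1 exc_sum big_ord0 scale1r.
by apply/esym/eqP/permP => -[].
Qed.

Lemma weighted_eulerian1 e : e ^+ 2 = 1 -> weighted_eulerian e 1 = 1.
Proof.
move=> e2; rewrite weighted_eulerianS // weighted_eulerian0.
by rewrite derivC mulr0 scaler0 mul0r scaler0 !addr0 mulr1.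
Qed.

Lemma signed_eulerianE (n : nat) :
  weighted_eulerian (-1) n.+1 = (1 - 'X) ^+ n.
Proof.
elim: n => [|n IH]; first by rewrite weighted_eulerian1 ?sqrrN ?expr1n.
rewrite weighted_eulerianS ?sqrrN ?expr1n // IH deriv_exp !derivE !scaleN1r.
(* The derivative of [(1 - 'X) ^+ n] carries the exponent [n.-1], which is truncated at [n = 0]. *)
case: n {IH} => [|n]; first by rewrite mulr0n expr0; ring.
by rewrite -mulr_natl /= !exprS; ring.
Qed.

Lemma eulerian_modXn (n N : nat) : exists r : {poly F},
  weighted_eulerian 1 n =
    (1 - 'X) ^+ n.+1 * \poly_(k < N) k.+1%:R ^+ n + r * 'X^N.
Proof.
elim: n => [|n [r IH]].
  (* Finite geometric sum: [1 = (1 - X)(1 + ... + X^(N-1)) + X^N]. *)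
  exists 1; rewrite weighted_eulerian0 mul1r expr1.
  have -> : \poly_(k < N) k.+1%:R ^+ 0 = \sum_(i < N) 'X^i :> {poly F}.
    by rewrite poly_def; apply: eq_bigr => i _; rewrite scale1r.
  by rewrite -opprB mulNr -subrX1 opprB subrK.
(* The operator multiplies the coefficient of [X^k] by [k = (k + 1) - 1]. *)
have euler_op : 'X * (\poly_(k < N) (k.+1%:R ^+ n : F))^`() =
    \poly_(k < N) k.+1%:R ^+ n.+1 - \poly_(k < N) k.+1%:R ^+ n.
  apply/polyP => -[|i]; rewrite coefB coefXM coef_deriv !coef_poly /=.
    by case: ifP; rewrite ?expr1n ?subrr.
  case: ifP; rewrite ?mul0rn ?subrr // => _.
  rewrite -[LHS]mulr_natl exprS -[X in _ - X]mul1r -mulrBl; congr (_ * _).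
  by rewrite -(natr1 i.+1) addrK.
set H := \poly_(k < N) k.+1%:R ^+ n in IH euler_op *.
set H' := \poly_(k < N) k.+1%:R ^+ n.+1 in euler_op *.
have XderivP : 'X * (weighted_eulerian 1 n)^`() =
    (1 - 'X) ^+ n.+1 * (H' - H) - n.+1%:R * 'X * (1 - 'X) ^+ n * H
    + ('X * r^`() + N%:R * r) * 'X^N.
  have -> : ('X * r^`() + N%:R * r) * 'X^N = 'X * r^`() * 'X^N + r * (N%:R * 'X^N).
    by ring.
  rewrite -euler_op -XderivXn IH derivD !derivM deriv_exp derivB derivC derivX.
  rewrite sub0r [n.+1.-1]/= -[(_ * _) *+ _]mulr_natl.
  by ring.
(* This is the recursion applied to the remainder [r * 'X^N]; in the main part the multiples of [H]
   cancel, leaving [(1 - X)^(n+2) H']. *)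
exists ((1 + n%:R * 'X) * r + (1 - 'X) * ('X * r^`() + N%:R * r)).
rewrite weighted_eulerianS ?expr1n // !scale1r mulrAC XderivP {1}IH.
by rewrite !exprS; ring.
Qed.

End Eulerian.

(** * Passage to even and odd permutations *)

Lemma AE_plusE (n : nat) :
  AE_plus n = 2%:R^-1 *: (weighted_eulerian rat 1 n + weighted_eulerian rat (-1) n).
Proof.
rewrite -big_split /= scaler_sumr /AE_plus big_mkcond; apply: eq_bigr => s _.
(* Half of [1 + (-1)^odd] is the indicator of the even permutations. *)
rewrite inE expr1n -scalerDl scalerA; case: (odd_perm s) => /=.
  by rewrite expr1 subrr mulr0 scale0r.
by rewrite expr0 mulVf // scale1r.
Qed.

Lemma AE_minusE (n : nat) :
  AE_minus n = 2%:R^-1 *: (weighted_eulerian rat 1 n - weighted_eulerian rat (-1) n).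
Proof.
rewrite -sumrB scaler_sumr /AE_minus big_mkcond; apply: eq_bigr => s _.
rewrite inE expr1n -scalerBl scalerA; case: (odd_perm s) => /=.
  by rewrite expr1 opprK mulVf // scale1r.
by rewrite expr0 subrr mulr0 scale0r.
Qed.

(* The case [n = 1] of [eulerian_modXn] says that [sum_k (k+1) t^k] is
   [1 / (1 - t)^2], so multiplying it by [(1 - t)^(n-1)] covers the signed sum. *)
Lemma signed_eulerian_modXn (F : fieldType) (n N : nat) : (0 < n)%N ->
  exists r : {poly F}, weighted_eulerian F (-1) n =
    (1 - 'X) ^+ n.+1 * \poly_(k < N) k.+1%:R + r * 'X^N.
Proof.
case: n => // n _; have [r] := @eulerian_modXn F 1 N.
rewrite weighted_eulerian1 ?expr1n // => one_eq.
exists ((1 - 'X) ^+ n * r); rewrite signed_eulerianE.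
rewrite -[LHS]mulr1 [X in _ * X = _]one_eq.
by rewrite -[n.+2]addn2 exprD mulrDr !mulrA.
Qed.

Theorem theorem1p7 (n : nat) (n_gt0 : (0 < n)%N) :
  fps_div (fps_of_poly (AE_plus n)) (fps_of_poly ((1 - 'X) ^+ n.+1))
    =1 (fun k : nat => (k.+1%:R ^+ n + k.+1%:R) / 2%:R)
  /\
  fps_div (fps_of_poly (AE_minus n)) (fps_of_poly ((1 - 'X) ^+ n.+1))
    =1 (fun k : nat => (k.+1%:R ^+ n - k.+1%:R) / 2%:R).
Proof.
have coef0_neq0 : ((1 - 'X) ^+ n.+1 : {poly rat})`_0 != 0.
  by rewrite -horner_coef0 horner_exp !hornerE expr1n oner_neq0.
split; apply: fps_div_polyE => // N; have [r1 E1] := @eulerian_modXn rat n N;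
  have [r2 E2] := @signed_eulerian_modXn rat n N n_gt0.
- exists (2%:R^-1 *: (r1 + r2)); rewrite AE_plusE E1 E2.
  have -> : \poly_(k < N) ((k.+1%:R ^+ n + k.+1%:R) / 2%:R) = 2%:R^-1 *:
      (\poly_(k < N) k.+1%:R ^+ n + \poly_(k < N) k.+1%:R) :> {poly rat}.
    apply/polyP => k; rewrite coefZ coefD !coef_poly mulrC.
    by case: ifP; rewrite ?addr0 ?mulr0.
  by rewrite -!mul_polyC; ring.
- exists (2%:R^-1 *: (r1 - r2)); rewrite AE_minusE E1 E2.
  have -> : \poly_(k < N) ((k.+1%:R ^+ n - k.+1%:R) / 2%:R) = 2%:R^-1 *:
      (\poly_(k < N) k.+1%:R ^+ n - \poly_(k < N) k.+1%:R) :> {poly rat}.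
    apply/polyP => k; rewrite coefZ coefB !coef_poly mulrC.
    by case: ifP; rewrite ?subr0 ?mulr0.
  by rewrite -!mul_polyC; ring.
Qed.
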